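(* Let $H_1$ and $H_2$ be selfadjoint relations in $\mathbb C^n$ and assume that $H_1\le H_2$. Let $\mathsf i_j^-$ be the number of negative eigenvalues of $H_j$ (counted with multiplicity), $j=1,2$. Then $$H_2^{-1}\le H_1^{-1}\quad\text{if and only if}\quad \mathsf i_1^-=\mathsf i_2^- .$$
   Context: A (linear) relation $H$ in $\mathfrak H=\mathbb C^n$ is a linear subspace of $\mathfrak H\times\mathfrak H$. Put $\operatorname{dom}H=\{h:\{h,k\}\in H\}$, $\operatorname{mul}H=\{k:\{0,k\}\in H\}$. Further $H^{-1}=\{\{k,h\}:\{h,k\}\in H\}$, $H-\lambda=\{\{h,k-\lambda h\}:\{h,k\}\in H\}$, and $H^*=\{\{h,k\}:(g,h)=(f,k)\text{ for all }\{f,g\}\in H\}$; $H$ is selfadjoint if $H=H^*$. A selfadjoint relation $H$ decomposes orthogonally as $H=H_s\,\widehat\oplus\,(\{0\}\times\operatorname{mul}H)$ with respect to $\mathfrak H=\operatorname{dom}H\oplus\operatorname{mul}H$, where $H_s=H\cap(\operatorname{dom}H\times\operatorname{dom}H)$ (the operator part) is a selfadjoint operator in $\operatorname{dom}H$. The (finite) eigenvalues of $H$, i.e. the $\lambda$ with $\{h,\lambda h\}\in H$ for some $h\neq0$, are those of $H_s$. The inverse is always taken in the sense of relations. The lower bound of $H$ is the supremum of all $m\in\mathbb R$ with $(H_sh,h)\ge m(h,h)$ for all $h\in\operatorname{dom}H$. Ordering: for selfadjoint relations $H_1,H_2$ with lower bounds $m_1,m_2$, $H_1\le H_2$ means that for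 some fixed $x<\min\{m_1,m_2\}$ (equivalently, for all such $x$) $0\le((H_2-x)^{-1}h,h)\le((H_1-x)^{-1}h,h)$ for all $h\in\mathfrak H$. (In $\mathbb C^n$ this is equivalent to: $\operatorname{dom}H_2\subset\operatorname{dom}H_1$ and $((H_1)_sh,h)\le((H_2)_sh,h)$ for all $h\in\operatorname{dom}H_2$.) *)

(* Defs.v *)
From HB Require Import structures.
From mathcomp Require Import all_boot all_order all_algebra.
From mathcomp Require Import finmap complex.
From mathcomp Require Import boolp classical_sets functions cardinality fsbigop reals constructive_ereal ereal.

Set Implicit Arguments.
Unset Strict Implicit.
Unset Printing Implicit Defensive.

Import Order.TTheory GRing.Theory Num.Theory.
Local Open Scope ring_scope.
Local Open Scope complex_scope.
Local Open Scope classical_set_scope.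

(** C^n is the type of row vectors 'rV[R[i]]_n, with the library inner product
    [dotmx u v], linear in [u] and conjugate-linear in [v].  Comparisons in
    R[i] use the partial order in which z <= w iff w - z is a nonnegative
    real; in particular l < 0 says that l is real and negative. *)

Notation linrel R n := {vspace ('rV[R[i]]_n * 'rV[R[i]]_n)%type}.

Section LinearRelations.
Variables (R : realType) (n : nat).
Local Notation C := R[i].
Local Notation V := 'rV[C]_n.
Implicit Types (H : linrel R n) (h k : V) (l : C).

(** [linfun f] is meaningful only when [f] is linear; the lemmas [mem_rel*]
    below establish the set-builder descriptions of the subspaces. *)

Definition reldom H : {vspace V} := (linfun (fun p : V * V => p.1) @: H)%VS.

Definition relinv H : linrel R n :=
  (linfun (fun p : V * V => (p.2, p.1)) @: H)%VS.

Definition relshift H l : linrel R n :=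
  (linfun (fun p : V * V => (p.1, p.2 - l *: p.1)) @: H)%VS.

Definition reladj H : set (V * V) :=
  [set p | forall f g, (f, g) \in H -> dotmx g p.1 = dotmx f p.2].

Definition selfadjoint H : Prop := [set p | p \in H] = reladj H.

Definition relop H : linrel R n :=
  (H :&: ((linfun (fun p : V * V => p.1) @^-1: reldom H) :&:
          (linfun (fun p : V * V => p.2) @^-1: reldom H)))%VS.

(** When dom H = 0 every real number is admissible and the value is +oo. *)
Definition lower_bound H : \bar R :=
  ereal_sup [set m%:E | m in
    [set m : R | forall h k, (h, k) \in relop H ->
                   m%:C * dotmx h h <= dotmx k h]].

(** For H selfadjoint and x below its lower bound, (H - x)^-1 is an
    everywhere defined operator, so k1 and k2 are the unique vectors
    (H1 - x)^-1 h and (H2 - x)^-1 h. *)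
Definition relle H1 H2 : Prop :=
  exists2 x : R, (x%:E < Order.min (lower_bound H1) (lower_bound H2))%E &
    forall h, exists k1 k2,
      [/\ (h, k1) \in relinv (relshift H1 x%:C),
          (h, k2) \in relinv (relshift H2 x%:C),
          0 <= dotmx k2 h &
          dotmx k2 h <= dotmx k1 h].

Definition releigenspace H l : {vspace V} :=
  (linfun (fun h : V => (h, l *: h)) @^-1: H)%VS.

(** Eigenvalues are counted with the dimension of their eigenspaces, which for
    selfadjoint H is the only notion of multiplicity.  For such H
    the sum over all l < 0 is finitely supported by [finite_releigenspace], so
    the default value on infinite supports does not intervene. *)
Definition num_neg_eigenvalues H : nat :=
  (\big[addn/0%N]_(l \in [set l : C | (l < 0)%R]) \dim (releigenspace H l))%N.

Let linfunE' (U W : vectType C) (f : U -> W) :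
  linear f -> forall u, linfun f u = f u.
Proof.
move=> lf u; pose F := GRing.isLinear.Build C U W *:%R f lf.
pose g : {linear U -> W} := HB.pack f F.
exact: (lfunE g).
Qed.

Let fst_lin : linear (fun p : V * V => p.1). Proof. by []. Qed.

Let snd_lin : linear (fun p : V * V => p.2). Proof. by []. Qed.

Let swap_lin : linear (fun p : V * V => (p.2, p.1)). Proof. by []. Qed.

Let shift_lin l : linear (fun p : V * V => (p.1, p.2 - l *: p.1)).
Proof.
move=> a [u1 u2] [v1 v2]; congr pair => /=.
by rewrite scalerDr scalerBr !scalerA opprD (mulrC l) addrACA.
Qed.

Let graph_lin l : linear (fun h : V => (h, l *: h)).
Proof.
by move=> a u v; congr pair => /=; rewrite scalerDr !scalerA (mulrC l).
Qed.

Lemma mem_reldom H h : h \in reldom H <-> exists k, (h, k) \in H.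
Proof.
split=> [/memv_imgP[[u v] Huv ->]|[k Hk]].
  by exists v; rewrite (linfunE' fst_lin).
by apply/memv_imgP; exists (h, k); rewrite ?(linfunE' fst_lin).
Qed.

Lemma mem_relinv H h k : ((k, h) \in relinv H) = ((h, k) \in H).
Proof.
apply/idP/idP=> [/memv_imgP[[u v] Huv]|Hk].
  by rewrite (linfunE' swap_lin) => -[-> ->].
by apply/memv_imgP; exists (h, k); rewrite ?(linfunE' swap_lin).
Qed.

Lemma mem_relshift H l h k :
  ((h, k - l *: h) \in relshift H l) = ((h, k) \in H).
Proof.
apply/idP/idP=> [/memv_imgP[[u v] Huv]|Hk].
  by rewrite (linfunE' (shift_lin l)) => -[-> /addIr ->].
by apply/memv_imgP; exists (h, k); rewrite ?(linfunE' (shift_lin l)).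
Qed.

Lemma mem_relop H h k :
  ((h, k) \in relop H) =
  [&& (h, k) \in H, h \in reldom H & k \in reldom H].
Proof.
by rewrite !memv_cap -!memv_preim (linfunE' fst_lin) (linfunE' snd_lin).
Qed.

Lemma mem_releigenspace H l h : (h \in releigenspace H l) = ((h, l *: h) \in H).
Proof. by rewrite -memv_preim (linfunE' (graph_lin l)). Qed.

Lemma finite_releigenspace H :
  selfadjoint H -> finite_set [set l | releigenspace H l != 0%VS].
Proof.
move=> saH; apply: contrapT => /(infinite_set_fset n.+1)[X Xsub leX].
have eig l : l \in X -> exists v, v != 0 /\ (v, l *: v) \in H.
  move=> /Xsub /= /eqP H0; exists (vpick (releigenspace H l)).
  by rewrite vpick0 -mem_releigenspace memv_pick; split => //; apply/eqP.
have adj f g f' g' : (f, g) \in H -> (f', g') \in H -> dotmx g f' = dotmx f g'.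
  move=> Hf Hf'; have : [set p | p \in H] (f', g') by [].
  by rewrite saH => /(_ _ _ Hf).
pose s := enum_fset X; have us : uniq s by exact: fset_uniq.
have lt_s (i : 'I_n.+1) : (i < size s)%N by exact: leq_trans leX.
have Pv (i : 'I_n.+1) : {v | v != 0 /\ (v, s`_i *: v) \in H}.
  by apply: cid; apply: eig; apply: (mem_nth 0 (lt_s i)).
pose v i := sval (Pv i).
have v0 i : v i != 0 by have [] := svalP (Pv i).
have vH i : (v i, s`_i *: v i) \in H by have [] := svalP (Pv i).
have dZl a (u w : V) : dotmx (a *: u) w = a * dotmx u w.
  by rewrite !dotmxE -scalemxAl mxE.
have dZr a (u w : V) : dotmx u (a *: w) = Num.conj a * dotmx u w.
  by rewrite !dotmxE linearZ /= map_mxZ -scalemxAr mxE.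
have d0 i : dotmx (v i) (v i) != 0.
  by rewrite lt0r_neq0 // (dnorm_gt0 (@dotmx C n)) v0.
have real (i : 'I_n.+1) : Num.conj s`_i = s`_i.
  by have := adj _ _ _ _ (vH i) (vH i); rewrite dZl dZr => /(mulIf (d0 i)).
have orth (i j : 'I_n.+1) : i != j -> dotmx (v i) (v j) = 0.
  move=> nij; have := adj _ _ _ _ (vH i) (vH j); rewrite dZl dZr real => /eqP.
  rewrite -subr_eq0 -mulrBl mulf_eq0 subr_eq0 nth_uniq // => /orP[|/eqP//].
  by move/eqP/val_inj/eqP; rewrite (negPf nij).
pose A := \matrix_i v i.
have : A *m map_mx Num.conj A^T = diag_mx (\row_i dotmx (v i) (v i)).
  apply/matrixP => i j; rewrite !mxE.
  transitivity (dotmx (v i) (v j)).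
    by rewrite dotmxE mxE; apply: eq_bigr => k _; rewrite !mxE.
  by have [->|/orth] := eqVneq i j; rewrite ?mulr1n ?mulr0n.
move/(congr1 (fun M => \rank M)) => E.
have: (\rank (A *m map_mx Num.conj A^T) <= n)%N.
  exact: leq_trans (mulmx_max_rank _ _) _.
rewrite E mxrank_unit ?ltnn // unitmxE det_diag unitfE.
by apply/prodf_neq0 => i _; rewrite mxE.
Qed.

End LinearRelations.

(* Main.v *)
Require Import Defs.
From mathcomp Require Import all_boot all_order all_algebra complex reals.
From mathcomp Require Import boolp classical_sets functions cardinality fsbigop constructive_ereal ereal.

(* Write t_H[h] = (k, h) for (h, k) in H.  Then H1 <= H2 means that dom H2 is
   contained in dom H1 and t_H1 <= t_H2 there ([form_le]).  The number of
   negative eigenvalues of H is the largest dimension of a subspace of dom H on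
   which t_H is negative definite; it is antitone in H and invariant under
   H |-> H^-1, which gives one implication.

   Conversely, if the two numbers agree, a maximal negative subspace N for H2 is
   maximal negative for H1 too, so t_H1 >= 0 on its t_H1-orthogonal complement.
   For (h1, k) in H1 this yields h2 with (h2, k) in H2.  Let g = h2 + m, with m the
   t_H1-orthogonal projection of h1 - h2 onto N.  Completing squares,
     (k, h1) - (k, h2) = t_H1[h1 - g] - t_H2[h2 - g] + t_H2[g] - t_H1[g] >= 0.
   The case N = 0, applied to resolvents, identifies [relle] with [form_le]. *)

Set Implicit Arguments.
Unset Strict Implicit.
Unset Printing Implicit Defensive.

Import Order.TTheory GRing.Theory Num.Theory.
Local Open Scope ring_scope.
Local Open Scope complex_scope.

Local Notation "''[' u , v ]" := (dotmx u v) : ring_scope.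
Local Notation "B ^*t" := (map_mx Num.conj B^T) (at level 8).

Section Forms.
Variables (R : realType) (n : nat).
Local Notation C := R[i].
Local Notation V := 'rV[C]_n.
Implicit Types (H : linrel R n) (h k u v w : V) (l : C).

(** * Inner products and selfadjoint relations *)

Lemma dotDl u v w : '[u + v, w] = '[u, w] + '[v, w].
Proof. exact: linearDl. Qed.
Lemma dotDr u v w : '[w, u + v] = '[w, u] + '[w, v].
Proof. exact: linearDr. Qed.
Lemma dotBl u v w : '[u - v, w] = '[u, w] - '[v, w].
Proof. exact: linearBl. Qed.
Lemma dotBr u v w : '[w, u - v] = '[w, u] - '[w, v].
Proof. exact: linearBr. Qed.
Lemma dotZl l u w : '[l *: u, w] = l * '[u, w].
Proof. by rewrite linearZl_LR. Qed.
Lemma dotZr l u w : '[w, l *: u] = Num.conj l * '[w, u].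
Proof. by rewrite linearZr_LR. Qed.
Lemma dot0l u : '[0, u] = 0.
Proof. exact: linear0l. Qed.
Lemma dot0r u : '[u, 0] = 0.
Proof. exact: linear0r. Qed.
Lemma dotC u v : Num.conj '[u, v] = '[v, u].
Proof. by rewrite [RHS]hermC expr0 mul1r. Qed.

Lemma relD H h k u v : (h, k) \in H -> (u, v) \in H -> (h + u, k + v) \in H.
Proof. exact: memvD. Qed.
Lemma relB H h k u v : (h, k) \in H -> (u, v) \in H -> (h - u, k - v) \in H.
Proof. exact: memvB. Qed.
Lemma relZ H l h k : (h, k) \in H -> (l *: h, l *: k) \in H.
Proof. exact: memvZ. Qed.

Lemma selfadjointP H : selfadjoint H ->
  forall h k, reflect (forall u v, (u, v) \in H -> '[v, h] = '[u, k]) ((h, k) \in H).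
Proof.
move=> saH h k.
have E : is_true ((h, k) \in H) = reladj H (h, k).
  exact: (f_equal (fun S : set (V * V) => S (h, k)) saH).
by apply: (iffP idP); rewrite E.
Qed.

Lemma sa_dot H h k u v : selfadjoint H ->
  (h, k) \in H -> (u, v) \in H -> '[v, h] = '[u, k].
Proof. by move=> saH /(selfadjointP saH); apply. Qed.

Lemma sa_dot_real H h k : selfadjoint H -> (h, k) \in H -> '[k, h] \is Num.real.
Proof. by move=> saH Hhk; rewrite CrealE dotC (sa_dot saH Hhk Hhk). Qed.

Lemma sa_dot_uniq H h k k' : selfadjoint H ->
  (h, k) \in H -> (h, k') \in H -> '[k, h] = '[k', h].
Proof.
by move=> saH Hk Hk'; rewrite (sa_dot saH Hk Hk') (sa_dot saH Hk Hk).
Qed.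

Lemma selfadjointI H :
  (forall h k, (h, k) \in H <-> forall u v, (u, v) \in H -> '[v, h] = '[u, k]) ->
  selfadjoint H.
Proof.
by move=> adj; apply/seteqP; split=> -[h k] /=; move/adj.
Qed.

Lemma selfadjoint_inv H : selfadjoint H -> selfadjoint (relinv H).
Proof.
move=> saH; apply: selfadjointI => h k; rewrite mem_relinv; split.
  by move=> Hkh u v; rewrite mem_relinv => Huv; rewrite (sa_dot saH Hkh Huv).
move=> adj; apply/(selfadjointP saH) => u v Huv.
by rewrite -(adj v u) // mem_relinv.
Qed.

Lemma mem_relshiftE H l h k : ((h, k) \in relshift H l) = ((h, k + l *: h) \in H).
Proof. by rewrite -(mem_relshift H l) addrK. Qed.

Lemma selfadjoint_shift H (x : R) : selfadjoint H -> selfadjoint (relshift H x%:C).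
Proof.
have xR : Num.conj x%:C = x%:C by apply/CrealP; rewrite complex_real.
move=> saH; apply: selfadjointI => h k; rewrite mem_relshiftE; split.
  move=> Hkh u v; rewrite mem_relshiftE => Huv.
  have := sa_dot saH Hkh Huv.
  by rewrite dotDl dotDr dotZl dotZr xR => /addIr.
move=> adj; apply/(selfadjointP saH) => u v Huv.
have /adj : (u, v - x%:C *: u) \in relshift H x%:C by rewrite mem_relshift.
by rewrite dotBl dotZl dotDr dotZr xR => <-; rewrite subrK.
Qed.

Lemma relinvK H : relinv (relinv H) = H.
Proof. by apply/vspaceP => -[h k]; rewrite !mem_relinv. Qed.

(* ran H is the orthogonal complement of ker H. *)
Lemma sa_ranP H w : selfadjoint H ->
  (forall g, (g, 0) \in H -> '[w, g] = 0) -> exists h, (h, w) \in H.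
Proof.
move=> saH wker; apply: contrapT => nw.
pose D := reldom (relinv H); have wD : w \notin D.
  by apply/negP => /mem_reldom[h]; rewrite mem_relinv => hw; apply: nw; exists h.
pose M := \matrix_(i < \dim D) tnth (vbasis D) i.
have wM : ~~ (w <= M)%MS.
  apply: contra wD => /submxP[c ->]; rewrite mulmx_sum_row.
  by apply: memv_suml => i _; rewrite rowK memvZ// vbasis_mem// mem_tnth.
(* Some column of [cokermx M] does not annihilate w. Its conjugate transpose g is orthogonal to ran
   H, hence in ker H, yet (w, g) is nonzero. *)
have /eqP/rowP/existsNP[j] : w *m cokermx M != 0 by rewrite -submxE.
apply; pose g : V := (col j (cokermx M))^*t.
have gE m (A : 'M_(m, n)) : A *m g^*t = A *m col j (cokermx M).
  by congr mulmx; apply/matrixP => i k; rewrite !mxE conjCK.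
have gH : (g, 0) \in H.
  apply/(selfadjointP saH) => u v Huv; rewrite dot0r dotmxE gE.
  have vM : (v <= M)%MS.
    have : v \in D by apply/mem_reldom; exists u; rewrite mem_relinv.
    move=> /coord_vbasis ->; apply: summx_sub => i _; apply: scalemx_sub.
    by rewrite -tnth_nth (_ : tnth _ i = row i M) ?row_sub ?rowK.
  by rewrite colE mulmxA (eqP (_ : v *m cokermx M == 0)) ?mul0mx ?mxE // -submxE.
by have := wker _ gH; rewrite dotmxE gE colE mulmxA -colE mxE => ->; rewrite mxE.
Qed.
(** As (k, h) = 0, the form at f + l h equals (w, f) + 2 Re (l (k, f)), which is affine in l and can
    stay nonnegative only if (k, f) = 0. *)
Lemma psd_isotropic_kernel H h k f w : selfadjoint H ->
  (h, k) \in H -> (f, w) \in H -> '[k, h] = 0 ->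
  (forall l, 0 <= '[w + l *: k, f + l *: h]) -> '[k, f] = 0.
Proof.
move=> saH Hk Hw kh0 psd; apply: contrapT => /eqP z0.
have a0 : 0 <= '[w, f] by have := psd 0; rewrite !scale0r !addr0.
have aR : Num.conj ('[w, f] + 1) = '[w, f] + 1.
  by apply/CrealP/ger0_real; rewrite addr_ge0.
(* With this l the form takes the value - (w, f) - 2 < 0. *)
pose t := - (('[w, f] + 1) / '[k, f]).
have tk : t * '[k, f] = - ('[w, f] + 1) by rewrite mulNr divfK.
have tw : Num.conj t * '[w, h] = - ('[w, f] + 1).
  by rewrite (sa_dot saH Hk Hw) -dotC -rmorphM tk rmorphN /= aR.
have := psd t; rewrite dotDl !dotDr !dotZl !dotZr kh0 !mulr0 addr0 tk tw.
rewrite {1}opprD addrA subrr sub0r -opprD oppr_ge0 lt_geF //.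
by rewrite ltr_wpDr ?ltr01 // addr_ge0.
Qed.

(** * The form order and negative subspaces *)

(** The existential contains dom H2 ⊂ dom H1. For selfadjoint H, mul H is orthogonal to dom H, so
    (k, h) depends on h alone and any image k gives the value of the operator part. *)
Definition form_le H1 H2 := forall h k2, (h, k2) \in H2 ->
  exists2 k1, (h, k1) \in H1 & '[k1, h] <= '[k2, h].

(* The rows of B span a negative subspace of dom H; c *m K is an image of c *m B.
   The rows of B are then automatically linearly independent. *)
Definition neg_family H r (B K : 'M[C]_(r, n)) := forall c : 'rV_r,
  (c *m B, c *m K) \in H /\ (c != 0 -> '[c *m K, c *m B] < 0).

(** For rows of B in dom H the condition on k is orthogonality of h to these rows with respect to
    t_H. When B has no rows, this says t_H >= 0. *)
Definition nonneg_off H r (B : 'M[C]_(r, n)) := forall h k, (h, k) \in H ->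
  (forall c : 'rV_r, '[k, c *m B] = 0) -> 0 <= '[k, h].

(** The Gram matrix [G] of t_H on the rows of B is invertible, since c in its left kernel would give
    (c K, c B) = 0. If k is an image of h, then c B is the t_H-orthogonal projection of h onto the
    row space. *)
Lemma neg_family_proj H r (B K : 'M[C]_(r, n)) k : neg_family H B K ->
  exists c : 'rV_r, forall c' : 'rV_r, '[k - c *m K, c' *m B] = 0.
Proof.
move=> neg; pose G := K *m B^*t.
have GE v c' : '[v, c' *m B] = (v *m B^*t *m c'^*t) 0 0.
  by rewrite dotmxE trmx_mul map_mxM mulmxA.
have uG : G \in unitmx.
  rewrite -row_free_unit -kermx_eq0; apply/rowV0P => c /sub_kermxP cG.
  apply: contrapT => /eqP /(neg c).2.
  by rewrite GE -(mulmxA c) cG mul0mx mxE ltxx.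
exists (k *m B^*t *m invmx G) => c'.
by rewrite GE mulmxBl -(mulmxA _ K) mulmxKV // subrr mul0mx mxE.
Qed.

Lemma neg_family_le0 H r (B K : 'M[C]_(r, n)) c :
  neg_family H B K -> '[c *m K, c *m B] <= 0.
Proof.
by move=> /(_ c)[_]; have [->|_ /(_ isT)/ltW//] := eqVneq c 0; rewrite mul0mx dot0l.
Qed.

(** The same rows serve: t_H1 <= t_H2 < 0 on nonzero combinations. Images under H1 are chosen row by
    row and extended linearly. *)
Lemma neg_family_form_le H1 H2 r (B K2 : 'M[C]_(r, n)) :
  selfadjoint H1 -> form_le H1 H2 -> neg_family H2 B K2 ->
  exists K1, neg_family H1 B K1.
Proof.
move=> sa1 le12 neg.
have /choice[k1 k1P] (i : 'I_r) : exists k, (row i B, k) \in H1.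
  have [Hi _] := neg (delta_mx 0 i).
  by have [k Hk _] := le12 _ _ Hi; exists k; rewrite rowE.
exists (\matrix_i k1 i) => c.
have Hc : (c *m B, c *m (\matrix_i k1 i)) \in H1.
  rewrite !mulmx_sum_row.
  have -> : (\sum_i c 0 i *: row i B, \sum_i c 0 i *: row i (\matrix_i k1 i)) =
     \sum_i c 0 i *: (row i B, k1 i) :> V * V.
    elim/big_rec3: _ => //= i u v w _ <-; by rewrite rowK.
  by apply: memv_suml => i _; apply: memvZ.
split=> // /(neg c).2; apply: le_lt_trans.
have [k Hk] := le12 _ _ (neg c).1.
by rewrite (sa_dot_uniq sa1 Hc Hk).
Qed.

Lemma regroup_sub (Z : zmodType) (a b c d e : Z) :
  a - b + (b + (d + e) - (c + d)) = a - c + e.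
Proof.
by rewrite -[X in _ + X]addrA subrKA [d + e]addrC [c + d]addrC addrKA addrA addrAC.
Qed.

(** * Inversion reverses the form order *)

(** It is shown that g is t_H1-orthogonal to the negative subspace and isotropic for t_H1. Since
    t_H1 is semidefinite on that complement, g is then t_H1-orthogonal to all of dom H1. *)
Lemma form_le_ker H1 H2 r (B K2 : 'M[C]_(r, n)) g :
  selfadjoint H1 -> selfadjoint H2 -> form_le H1 H2 ->
  neg_family H2 B K2 -> nonneg_off H1 B ->
  (g, 0) \in H2 -> (g, 0) \in H1.
Proof.
move=> sa1 sa2 le12 neg2 pos1 Hg.
have [K1 neg1] := neg_family_form_le sa1 le12 neg2.
have [k1 Hk1 _] := le12 _ _ Hg.
have [c k1c] := neg_family_proj k1 neg1.
have Hd := relB Hk1 (neg1 c).1.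
(* Since g is in ker H2, 0 <= t_H1[g - c B] <= t_H2[g - c B] = t_H2[c B], which is negative unless c
   = 0. *)
have c0 : c = 0.
  apply: contrapT => /eqP /(neg2 c).2.
  have H2d := relB Hg (neg2 c).1.
  have [k' Hk'] := le12 _ _ H2d.
  rewrite (sa_dot_uniq sa1 Hk' Hd) => /(le_trans (pos1 _ _ Hd k1c)).
  rewrite sub0r -scaleN1r dotZl dotBr (sa_dot sa2 Hg (neg2 c).1) dot0r sub0r.
  by rewrite mulrNN mul1r => /le_gtF ->.
move: Hd k1c; rewrite c0 !mul0mx !subr0 => Hd k1B.
suff H0 : (0, k1) \in H1 by have := relB Hk1 H0; rewrite subr0 subrr.
apply/(selfadjointP sa1) => f w Hw; rewrite dot0r.
have [d wd] := neg_family_proj w neg1.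
have Hf := relB Hw (neg1 d).1.
have gk1 : '[k1, g] = 0.
  apply/eqP; rewrite eq_le pos1 // andbT.
  have [k' Hk'] := le12 _ _ Hg.
  by rewrite (sa_dot_uniq sa1 Hk' Hk1) dot0l.
have : '[k1, f - d *m B] = 0.
  apply: (psd_isotropic_kernel sa1 Hk1 Hf gk1) => l.
  apply: pos1 => [|c']; first by apply: relD => //; apply: relZ.
  by rewrite dotDl wd dotZl k1B mulr0 addr0.
by rewrite dotBr k1B subr0 -dotC => /eqP; rewrite conjC_eq0 => /eqP ->.
Qed.

Lemma form_le_inv H1 H2 r (B K2 : 'M[C]_(r, n)) :
  selfadjoint H1 -> selfadjoint H2 -> form_le H1 H2 ->
  neg_family H2 B K2 -> nonneg_off H1 B ->
  form_le (relinv H2) (relinv H1).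
Proof.
move=> sa1 sa2 le12 neg2 pos1 k h1; rewrite mem_relinv => Hh1.
have [K1 neg1] := neg_family_form_le sa1 le12 neg2.
(* ker H2 ⊂ ker H1, and k, lying in ran H1, is orthogonal to ker H1; so k is in ran H2. *)
have [h2 Hh2] : exists h2, (h2, k) \in H2.
  apply: sa_ranP => // g /(form_le_ker sa1 sa2 le12 neg2 pos1) Hg.
  by rewrite (sa_dot sa1 Hg Hh1) dot0r.
exists h2; first by rewrite mem_relinv.
have [w Hw _] := le12 _ _ Hh2.
(* k - w is an image of h1 - h2 under H1, so c B is the projection m of h1 - h2 onto N. *)
have [c wc] := neg_family_proj (k - w) neg1.
have {}wc c' : '[k - (w + c *m K1), c' *m B] = 0 by rewrite opprD addrA.
have Hg2 := relD Hh2 (neg2 c).1; have Hg1 := relD Hw (neg1 c).1.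
have := pos1 _ _ (relB Hh1 Hg1) wc.
have [k' Hk'] := le12 _ _ Hg2; rewrite (sa_dot_uniq sa1 Hk' Hg1).
set g := h2 + _; set w1 := w + _; rewrite dotDl => leg.
have := neg_family_le0 c neg2; set n0 := c *m B; set m0 := c *m K2 => le0.
rewrite dotBl !dotBr (sa_dot sa1 Hh1 Hg1) opprB.
rewrite (sa_dot sa1 Hh1 Hh1) => pos.
have m0g : '[m0, g] = '[n0, k] + '[m0, n0].
  by rewrite dotDr (sa_dot sa2 Hh2 (neg2 c).1).
have gk : '[g, k] = '[h2, k] + '[n0, k] := dotDl _ _ _.
(* t_H1[h1 - g] >= 0 is expanded and t_H1[g] replaced by the larger t_H2[g]. What remains is (h1, k)
   - (h2, k) plus t_H2[m] <= 0. *)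
have : 0 <= '[h1, k] - '[k, g] + ('[k, g] + '[m0, g] - '[g, k]).
  by rewrite (le_trans pos) // lerD2l lerD2r.
have -> : '[h1, k] - '[k, g] + ('[k, g] + '[m0, g] - '[g, k]) =
    '[h1, k] - '[h2, k] + '[m0, n0].
    by rewrite m0g gk; exact: regroup_sub.
by move=> /le_trans le0m; rewrite -subr_ge0 le0m // gerDl.
Qed.

(** * From the resolvent order to the form order *)

Lemma dot_delta u j : '[u, delta_mx 0 j] = u 0 j.
Proof. by rewrite dotmxE trmx_delta map_delta_mx -colE mxE. Qed.

Lemma neg_family_empty H : neg_family H (0 : 'M_(0, n)) 0.
Proof. by move=> c; rewrite thinmx0 !mul0mx mem0v eqxx; split. Qed.

Lemma form_le_shift H1 H2 (x : R) :
  form_le (relshift H1 x%:C) (relshift H2 x%:C) <-> form_le H1 H2.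
Proof.
split=> le12 h k.
  move=> Hh; have := le12 h (k - x%:C *: h); rewrite mem_relshift => /(_ Hh)[k1].
  rewrite mem_relshiftE => Hk1 le1; exists (k1 + x%:C *: h); first exact: Hk1.
  by rewrite dotDl -lerBrDr -dotBl; exact: le1.
rewrite mem_relshiftE => /le12[k1 Hk1].
rewrite (dotDl k) -(lerBlDr _ '[_ *: _, _]) -dotBl => le1.
by exists (k1 - x%:C *: h); [rewrite mem_relshift | exact: le1].
Qed.

(** The resolvents at x are selfadjoint, have nonnegative forms and are ordered as forms, so
    inverting them with the empty negative family gives the form order of H1 - x and H2 - x. *)
Lemma relle_form_le H1 H2 : selfadjoint H1 -> selfadjoint H2 ->
  relle H1 H2 -> form_le H1 H2.
Proof.
move=> sa1 sa2 [x _ le12]; apply/(form_le_shift _ _ x).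
pose K H := relinv (relshift H x%:C).
have saK H : selfadjoint H -> selfadjoint (K H).
  by move=> saH; apply/selfadjoint_inv/selfadjoint_shift.
have le21 : form_le (K H2) (K H1).
  move=> h k1' Hk1'; have [k1 [k2 [Hk1 Hk2 _ lek]]] := le12 h.
  by exists k2; [exact: Hk2 | rewrite (sa_dot_uniq (saK _ sa1) Hk1' Hk1)].
have pos2 : nonneg_off (K H2) (0 : 'M_(0, n)).
  move=> h k Hk _; have [k1 [k2 [_ Hk2 pos _]]] := le12 h.
  by rewrite (sa_dot_uniq (saK _ sa2) Hk Hk2).
have := form_le_inv (saK _ sa2) (saK _ sa1) le21 (neg_family_empty _) pos2.
by rewrite !relinvK.
Qed.

(** * Spectral representation *)

(** Only finitely many numbers are eigenvalues, so some natural number is not. *)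
Lemma exists_resolvent_real H : selfadjoint H ->
  exists x : R, forall h, (h, x%:C *: h) \in H -> h = 0.
Proof.
move=> saH; have fin := finite_releigenspace saH.
apply: contrapT => /forallNP eig.
pose S := [set m : nat | releigenspace H (m%:R : R)%:C != 0%VS]%classic.
have : finite_set S.
  apply: (finite_preimage (f := fun m : nat => (m%:R : R)%:C)) fin => m p _ _.
  by move=> /complexI /eqP; rewrite eqr_nat => /eqP.
suff -> : S = [set: nat]%classic by apply: infinite_nat.
apply/seteqP; split=> // m _ /=; have /existsNP[h /not_implyP[Hh h0]] := eig m%:R.
by apply/eqP => E; apply: h0; apply/eqP; rewrite -memv0 -E mem_releigenspace.
Qed.

(* Diagonalises the everywhere defined Hermitian operator (H - x)^-1, for x real
   outside the spectrum; the zeros of [d] account for mul H. *)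
Lemma selfadjoint_spectral H : selfadjoint H ->
  exists (x : R) (P : 'M[C]_n) (d : 'I_n -> C),
    [/\ P \is unitarymx, forall i, d i \is Num.real &
      forall h k, (h, k) \in H <->
        forall i, (h *m P^*t) 0 i =
          d i * ((k *m P^*t) 0 i - x%:C * (h *m P^*t) 0 i)].
Proof.
move=> saH; have [x xP] := exists_resolvent_real saH.
have saX := selfadjoint_shift x saH.
(* H - x has trivial kernel, hence full range. *)
have /choice[a aP] (w : V) : exists h, (h, w) \in relshift H x%:C.
  apply: sa_ranP => // g; rewrite mem_relshiftE add0r => /xP ->.
  by rewrite dot0r.
pose A := \matrix_i a (delta_mx 0 i).
have AP w : (w *m A, w) \in relshift H x%:C.
  rewrite mulmx_sum_row {2}(row_sum_delta w).
  have -> : (\sum_i w 0 i *: row i A, \sum_i w 0 i *: delta_mx 0 i) =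
     \sum_i w 0 i *: (a (delta_mx 0 i), delta_mx 0 i) :> V * V.
    elim/big_rec3: _ => //= i u v t _ <-; by rewrite rowK.
  by apply: memv_suml => i _; apply: memvZ.
have memH h k : (h, k) \in H <-> h = (k - x%:C *: h) *m A.
  split=> [Hk|hA].
    apply/eqP; rewrite -subr_eq0; apply/eqP/xP.
    have := AP (k - x%:C *: h); rewrite mem_relshiftE => /(relB Hk).
    by rewrite opprD opprB addrA addrCA subrr addr0 -scalerBr.
  by have := AP (k - x%:C *: h); rewrite -hA mem_relshift.
have herm : A \is hermsymmx.
  apply/is_hermitianmxP; rewrite expr0 scale1r; apply/matrixP => i j.
  have := sa_dot saX (AP (delta_mx 0 j)) (AP (delta_mx 0 i)).
  by rewrite -dotC !dot_delta -!rowE !mxE.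
have PU := spectral_unitarymx A.
exists x, (spectralmx A), (fun i => spectral_diag A 0 i); split=> //.
  by move=> i; have /mxOverP := hermitian_spectral_diag_real herm; apply.
have /orthomx_spectralP := hermitian_normalmx herm.
set P := spectralmx A; set D := spectral_diag A => AE.
have PP : P^*t *m P = 1%:M by rewrite -invmx_unitary // mulVmx ?unitarymx_unit.
have PP' : P *m P^*t = 1%:M by apply/unitarymxP.
move=> h k.
have {}memH : (h, k) \in H <->
    h *m P^*t = (k *m P^*t - x%:C *: (h *m P^*t)) *m diag_mx D.
  rewrite memH scalemxAl -mulmxBl AE invmx_unitary //.
  split=> [E|E]; first by rewrite {1}E -!mulmxA PP' mulmx1.
  by rewrite -[LHS]mulmx1 -PP mulmxA E !mulmxA.
move: memH; set u := h *m _; set v := k *m _ => memH.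
split=> [Hk i|E]; first by have /rowP/(_ i) := memH.1 Hk; rewrite mul_mx_diag !mxE mulrC.
by apply: memH.2; apply/rowP => i; rewrite mul_mx_diag E !mxE mulrC.
Qed.

Lemma dot_unitary (P : 'M[C]_n) u v : P \is unitarymx ->
  '[u, v] = \sum_i (u *m P^*t) 0 i * Num.conj ((v *m P^*t) 0 i).
Proof.
move=> PU; have PP : P^*t *m P = 1%:M.
  by rewrite -invmx_unitary // mulVmx ?unitarymx_unit.
transitivity ((u *m P^*t *m (v *m P^*t)^*t) 0 0).
  by rewrite dotmxE trmx_mul map_mxM trmxCK mulmxA -(mulmxA u) PP mulmx1.
by rewrite mxE; apply: eq_bigr => i _; rewrite !mxE.
Qed.

(* For selfadjoint H: an orthonormal basis (the rows of P) in which H is the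
   span of the pairs (e_i, lam_i e_i), i in F, and (0, e_i), i not in F. *)
Definition diagonalizes (P : 'M[C]_n) (F : {set 'I_n}) (lam : 'I_n -> C) H :=
  [/\ P \is unitarymx, forall i, lam i \is Num.real &
    forall h k, (h, k) \in H <-> forall i,
      if i \in F then (k *m P^*t) 0 i = lam i * (h *m P^*t) 0 i
      else (h *m P^*t) 0 i = 0].

Lemma selfadjoint_diagonalizes H : selfadjoint H ->
  exists P F lam, diagonalizes P F lam H.
Proof.
move=> /selfadjoint_spectral[x [P [d [PU dR memH]]]].
(* A nonzero eigenvalue d_i of (H - x)^-1 gives the eigenvalue x + 1/d_i of H; d_i = 0 marks a
   direction of mul H. *)
exists P, [set i | d i != 0], (fun i => x%:C + (d i)^-1); split=> //.
  by move=> i; rewrite realD ?realV ?dR // complex_real.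
move=> h k; rewrite memH; set u := h *m _; set v := k *m _.
split=> E i; have := E i; rewrite inE; case: (eqVneq (d i) 0) => /= [->|d0].
- by rewrite mul0r.
- by move=> Ei; rewrite mulrDl {2}Ei mulKf // addrC subrK.
- by rewrite mul0r.
- by move=> ->; rewrite mulrDl addrAC subrr add0r mulVKf.
Qed.

Lemma diagonalizes_form P F lam H h k : diagonalizes P F lam H ->
  (h, k) \in H -> '[k, h] = \sum_i lam i * `|(h *m P^*t) 0 i| ^+ 2.
Proof.
move=> [PU lamR memH] /memH Hhk; rewrite (dot_unitary _ _ PU).
apply: eq_bigr => i _; have := Hhk i; rewrite normCK mulrA.
by case: ifP => _ -> //; rewrite conjC0 !mulr0.
Qed.

(** * From the form order to the resolvent order *)

Lemma form_bounded_below H : selfadjoint H ->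
  exists m : R, forall h k, (h, k) \in H -> m%:C * '[h, h] <= '[k, h].
Proof.
move=> /selfadjoint_diagonalizes[P [F [lam diag]]]; have [PU lamR memH] := diag.
pose M := \sum_i `|lam i|; have M0 : 0 <= M by apply: sumr_ge0.
(* Every eigenvalue is at least - M; the real part turns M into an element of R. *)
exists (- complex.Re M) => h k Hhk.
rewrite rmorphN /= RRe_real ?ger0_real //.
rewrite (diagonalizes_form diag Hhk) (dot_unitary _ _ PU) mulr_sumr.
apply: ler_sum => i _; rewrite -normCK ler_wpM2r ?exprn_ge0 //.
rewrite lerNl (le_trans (_ : _ <= `|lam i|)) //; first by rewrite -normrN real_ler_norm ?realN.
by rewrite /M (bigD1 i) //= lerDl sumr_ge0.
Qed.

Lemma form_le_relle H1 H2 : selfadjoint H1 -> selfadjoint H2 ->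
  form_le H1 H2 -> relle H1 H2.
Proof.
move=> sa1 sa2 le12.
have [m1 m1P] := form_bounded_below sa1; have [m2 m2P] := form_bounded_below sa2.
(* The margin 1 puts x strictly below both lower bounds and makes both shifted forms at least (h,
   h), so their kernels are trivial. *)
pose x := Order.min m1 m2 - 1.
have x1 : x + 1 <= m1 by rewrite subrK ge_min lexx.
have x2 : x + 1 <= m2 by rewrite subrK ge_min lexx orbT.
have lb H (m : R) : (forall h k, (h, k) \in H -> m%:C * '[h, h] <= '[k, h]) ->
    x + 1 <= m -> (x%:E < lower_bound H)%E.
  move=> mP xm; apply: (@lt_le_trans _ _ m%:E).
    by rewrite lte_fin (lt_le_trans _ xm) // ltrDl.
  apply: ereal_sup_ubound; exists m => // h k; rewrite mem_relop => /andP[Hhk _].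
  exact: mP.
have pos H (m : R) : (forall h k, (h, k) \in H -> m%:C * '[h, h] <= '[k, h]) ->
    x + 1 <= m -> forall h k, (h, k) \in relshift H x%:C -> '[h, h] <= '[k, h].
  move=> mP xm h k; rewrite mem_relshiftE => /mP.
  rewrite dotDl dotZl -lerBlDr -mulrBl -rmorphB; apply: le_trans.
  rewrite -[leLHS]mul1r ler_wpM2r ?dnorm_ge0 //.
  by rewrite -[leLHS]/((1 : R)%:C) lecR lerBrDl.
have onto H (m : R) : selfadjoint H ->
    (forall h k, (h, k) \in H -> m%:C * '[h, h] <= '[k, h]) ->
    x + 1 <= m -> forall h, exists k, (h, k) \in relinv (relshift H x%:C).
  move=> saH mP xm h.
  have [//|k Hk] := sa_ranP (w := h) (selfadjoint_shift x saH); last first.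
    by exists k; rewrite mem_relinv.
  move=> g /(pos _ _ mP xm); rewrite dot0l => g0.
  suff -> : g = 0 by rewrite dot0r.
  by apply/eqP; rewrite -(dnorm_eq0 (@dotmx C n)) eq_le g0 dnorm_ge0.
exists x; first by rewrite lt_min (lb _ _ m1P x1) (lb _ _ m2P x2).
have sa1x := selfadjoint_shift x sa1; have sa2x := selfadjoint_shift x sa2.
have /(form_le_shift _ _ x) le12x := le12.
have pos1 : nonneg_off (relshift H1 x%:C) (0 : 'M_(0, n)).
  by move=> h k /(pos _ _ m1P x1) le _; apply: le_trans le; apply: dnorm_ge0.
have le21 := form_le_inv sa1x sa2x le12x (neg_family_empty _) pos1.
move=> h; have [k1 Hk1] := onto _ _ sa1 m1P x1 h.
have [k2 Hk2 lek] := le21 _ _ Hk1; exists k1, k2; split; [done|done| |exact: lek].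
move: Hk2; rewrite mem_relinv => Hk2; rewrite -(sa_dot sa2x Hk2 Hk2).
by apply: le_trans (pos _ _ m2P x2 _ _ Hk2); apply: dnorm_ge0.
Qed.

(** * Counting negative eigenvalues *)

(** By P P^* = 1, the rows of P indexed by S embed C^|S| as a coordinate subspace in the basis P. *)
Lemma coord_rowsub (P : 'M[C]_n) (S : {set 'I_n}) (c : 'rV_#|S|) : P \is unitarymx ->
  (forall j, (c *m rowsub enum_val P *m P^*t) 0 (enum_val j) = c 0 j) /\
  (forall i, i \notin S -> (c *m rowsub enum_val P *m P^*t) 0 i = 0).
Proof.
move=> /unitarymxP PU.
have E i : (c *m rowsub enum_val P *m P^*t) 0 i =
    \sum_(j < #|S|) c 0 j * (enum_val j == i)%:R.
  rewrite -mulmxA mul_rowsub_mx PU mxE; apply: eq_bigr => j _.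
  by rewrite !mxE.
split=> [j|i iS]; rewrite E.
  rewrite (bigD1 j) //= eqxx mulr1 big1 ?addr0 // => k kj.
  by rewrite (inj_eq enum_val_inj) (negPf kj) mulr0.
rewrite big1 // => j _; case: eqP => [ji|]; last by rewrite mulr0.
by rewrite -ji enum_valP in iS.
Qed.

Lemma dim_coord_subspace (P : 'M[C]_n) (S : {set 'I_n}) (U : {vspace V}) :
  P \is unitarymx ->
  (forall h, h \in U <-> forall i, i \notin S -> (h *m P^*t) 0 i = 0) ->
  \dim U = #|S|.
Proof.
move=> PU UP; have PP : P^*t *m P = 1%:M.
  by rewrite -invmx_unitary // mulVmx ?unitarymx_unit.
pose f : 'Hom('rV[C]_#|S|, V) := linfun (mulmxr (rowsub enum_val P)).
have fE c : f c = c *m rowsub enum_val P by rewrite lfunE.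
have cE (c : 'rV_#|S|) := coord_rowsub c PU.
have -> : U = limg f.
  apply/vspaceP => h; apply/idP/memv_imgP => [/UP hS|[c _ ->]].
    exists (colsub enum_val (h *m P^*t)); rewrite ?memvf // fE.
    rewrite -[LHS]mulmx1 -[RHS]mulmx1 -PP !mulmxA; congr mulmx.
    apply/rowP => i; have [iS|iS] := boolP (i \in S); last first.
      by rewrite hS // (cE _).2.
    by rewrite -(enum_rankK_in iS iS) (cE _).1 [RHS]mxE.
  by apply/UP => i iS; rewrite fE (cE c).2.
rewrite limg_dim_eq; last first.
  apply/eqP; rewrite capfv -subv0; apply/subvP => c; rewrite memv_ker fE memv0 => /eqP c0.
  by apply/eqP/rowP => j; rewrite -(cE c).1 c0 mul0mx !mxE.
by rewrite dimvf /dim /= mul1n.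
Qed.

(** Each eigenspace is the coordinate subspace of the i in F with lam_i = l; summing over l < 0
    counts every such i with lam_i < 0 once. *)
Lemma num_neg_diagonalizes P F lam H : diagonalizes P F lam H ->
  num_neg_eigenvalues H = #|[set i in F | lam i < 0]|.
Proof.
move=> [PU lamR memH].
have dimE l : \dim (releigenspace H l) = #|[set i in F | lam i == l]|.
  apply: (dim_coord_subspace PU) => h; rewrite mem_releigenspace memH.
  rewrite -scalemxAl; move: (h *m _) => u.
  split=> E i; have := E i; rewrite !inE mxE; case: ifP => //= _.
  - move=> El nl; apply/eqP; move/eqP: El.
    by rewrite -subr_eq0 -mulrBl mulf_eq0 subr_eq0 eq_sym (negPf nl).
  - by case: eqP => [->|_ ->]; rewrite ?mulr0.
  - by move=> ->.
pose I := [set i in F | lam i < 0].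
(* A finite list outside which every negative l has zero eigenspace. *)
pose s : seq C := [seq l <- undup [seq lam i | i <- enum 'I_n] | l < 0].
have us : uniq s by rewrite filter_uniq ?undup_uniq.
have memI i : i \in I -> lam i \in s.
  by rewrite inE mem_filter mem_undup map_f ?mem_enum // => /andP[_ ->].
have sI l : l \in s -> l < 0 by rewrite mem_filter => /andP[].
rewrite /num_neg_eigenvalues (fsbigE s) //; first last.
  move=> l /= l0 ls; rewrite dimE; apply: eq_card0 => i.
  rewrite !inE; apply/negP => /andP[iF /eqP il].
  by move: ls; rewrite -il memI // inE iF il.
transitivity (\sum_(l <- s | l \in [set l : C | (l < 0)%R]%classic)
    \sum_(i in I) (lam i == l))%N.
  apply: eq_bigr => l; rewrite inE /= => l0; rewrite dimE -sum1_card big_mkcond [RHS]big_mkcond /=.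
  apply: eq_bigr => i _; rewrite !inE; case: (i \in F) => //=.
  by case: eqP => [->|_]; rewrite ?l0 //; case: ifP.
rewrite exchange_big /= -sum1_card; apply: eq_bigr => i iI.
rewrite big_mkcond (bigD1_seq (lam i)) ?us ?memI //= eqxx big1 ?addn0.
  by rewrite mem_set //= sI // memI.
by move=> l /negPf; rewrite eq_sym => ->; case: ifP.
Qed.

(** The eigenvectors with negative eigenvalue form the family. *)
Lemma exists_neg_family H : selfadjoint H ->
  exists B K : 'M[C]_(num_neg_eigenvalues H, n), neg_family H B K.
Proof.
move=> /selfadjoint_diagonalizes[P [F [lam diag]]].
rewrite (num_neg_diagonalizes diag); have [PU lamR memH] := diag.
set I := [set i in F | lam i < 0].
have iF i : i \notin F -> i \notin I by rewrite inE => /negPf ->.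
pose L := \row_(j < #|I|) lam (enum_val j).
exists (rowsub enum_val P), (diag_mx L *m rowsub enum_val P) => c.
have cE (a : 'rV_#|I|) := coord_rowsub a PU.
have Hc : (c *m rowsub enum_val P, c *m (diag_mx L *m rowsub enum_val P)) \in H.
  apply/memH => i; rewrite mulmxA; case: ifP => [_|/negbT /iF]; last exact: (cE c).2.
  have [iI|iI] := boolP (i \in I); last by rewrite !(cE _).2 // mulr0.
  by rewrite -(enum_rankK_in iI iI) !(cE _).1 mul_mx_diag !mxE mulrC.
split=> // c0; rewrite (diagonalizes_form diag Hc).
have /rV0Pn[j cj] := c0.
have le0 i : lam i * `|(c *m rowsub enum_val P *m P^*t) 0 i| ^+ 2 <= 0.
  have [|iI] := boolP (i \in I); last by rewrite (cE c).2 // normr0 expr0n mulr0.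
  by rewrite inE => /andP[_ /ltW l0]; rewrite mulr_le0_ge0 // exprn_ge0.
rewrite (bigD1 (enum_val j)) //= ltr_wnDr ?sumr_le0 // (cE c).1.
have := enum_valP j; rewrite inE => /andP[_ l0].
by rewrite nmulr_rlt0 // exprn_gt0 // normr_gt0.
Qed.

(** Projection of the row space onto the negative eigendirections is injective: a combination it
    kills has only nonnegative terms in its form, so its coefficients vanish. *)
Lemma neg_family_le_num_neg H r (B K : 'M[C]_(r, n)) : selfadjoint H ->
  neg_family H B K -> (r <= num_neg_eigenvalues H)%N.
Proof.
move=> /selfadjoint_diagonalizes[P [F [lam diag]]] neg.
rewrite (num_neg_diagonalizes diag); have [PU lamR memH] := diag.
set I := [set i in F | lam i < 0].
pose M := colsub (enum_val : 'I_#|I| -> 'I_n) (B *m P^*t).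
suff /eqP <- : row_free M by apply: rank_leq_col.
rewrite -kermx_eq0; apply/rowV0P => c /sub_kermxP /rowP cM.
apply: contrapT => /eqP /(neg c).2; rewrite (diagonalizes_form diag (neg c).1).
suff ge0 : 0 <= \sum_i lam i * `|(c *m B *m P^*t) 0 i| ^+ 2 by rewrite (le_gtF ge0).
apply: sumr_ge0 => i _; have [iI|] := boolP (i \in I).
  have := cM (enum_rank_in iI i).
  rewrite /M mulmx_colsub mulmxA [LHS]mxE enum_rankK_in // => ->.
  by rewrite mxE normr0 expr0n mulr0.
have /memH/(_ i) := (neg c).1; rewrite inE; case: ifP => [_ _|_ -> _] /=.
  by rewrite -real_leNgt ?real0 // => l0; rewrite mulr_ge0 // exprn_ge0.
by rewrite normr0 expr0n mulr0.
Qed.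

(* If (k, h) < 0, adjoining h to B would give a larger negative family. *)
Lemma max_neg_family_nonneg_off H (B K : 'M[C]_(num_neg_eigenvalues H, n)) :
  selfadjoint H -> neg_family H B K -> nonneg_off H B.
Proof.
move=> saH neg h k Hhk kB; have kR := sa_dot_real saH Hhk.
rewrite real_leNgt ?real0 //; apply/negP => kh0.
suff /(neg_family_le_num_neg saH) : neg_family H (col_mx B h) (col_mx K k).
  by rewrite addn1 ltnn.
move=> c; rewrite -[c]hsubmxK !mul_row_col.
set a := lsubmx c; set b := rsubmx c; rewrite [b]mx11_scalar !mul_scalar_mx.
set t := b 0 0; split; first exact: relD (neg a).1 (relZ _ Hhk).
(* The cross terms vanish, so the form is t_H[a B] + |t|^2 t_H[h]. *)
move=> c0; have ha : '[a *m K, h] = 0.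
  by rewrite (sa_dot saH Hhk (neg a).1) -dotC kB conjC0.
rewrite dotDl !dotDr !dotZl !dotZr ha kB !mulr0 addr0 add0r mulrA -normCK.
have [a0|a0] := eqVneq a 0; last first.
  by rewrite ltr_wnDr ?(neg a).2 // mulr_ge0_le0 ?exprn_ge0 // ltW.
rewrite a0 mul0mx dot0l add0r pmulr_rlt0 // exprn_gt0 // normr_gt0.
apply: contra c0 => /eqP t0; apply/eqP.
by rewrite a0 t0 raddf0 row_mx0.
Qed.

(** * Behaviour of the count under inversion and order *)

Lemma releigenspace_relinv H l : l != 0 ->
  releigenspace (relinv H) l = releigenspace H l^-1.
Proof.
move=> l0; apply/vspaceP => h.
rewrite [LHS]mem_releigenspace [LHS]mem_relinv [RHS]mem_releigenspace.
apply/idP/idP => Hh.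
  by have := relZ l^-1 Hh; rewrite scalerA mulVf // scale1r.
by have := relZ l Hh; rewrite scalerA mulfV // scale1r.
Qed.

(** The substitution l -> 1/l permutes the negative numbers and matches the eigenspaces. *)
Lemma num_neg_relinv H : num_neg_eigenvalues (relinv H) = num_neg_eigenvalues H.
Proof.
rewrite /num_neg_eigenvalues.
rewrite (@reindex_fsbig _ _ _ _ _ (fun l : C => l^-1) [set l | l < 0]%classic); last first.
  split=> [l|l1 l2 _ _|l] /=; first by rewrite invr_lt0.
    exact: invr_inj.
  by move=> l0; exists l^-1; rewrite ?invrK // invr_lt0.
apply: eq_fsbigr => l; rewrite inE /= => l0.
by rewrite releigenspace_relinv ?invrK // invr_neq0 // lt_eqF.
Qed.

Lemma form_le_num_neg H1 H2 : selfadjoint H1 -> selfadjoint H2 ->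
  form_le H1 H2 -> (num_neg_eigenvalues H2 <= num_neg_eigenvalues H1)%N.
Proof.
move=> sa1 sa2 le12; have [B [K neg]] := exists_neg_family sa2.
by have [K1 /(neg_family_le_num_neg sa1)] := neg_family_form_le sa1 le12 neg.
Qed.

End Forms.

Theorem theorem1p2 (R : realType) (n : nat) (H1 H2 : linrel R n)
    (sa1 : selfadjoint H1) (sa2 : selfadjoint H2) (le12 : relle H1 H2) :
  relle (relinv H2) (relinv H1) <->
  num_neg_eigenvalues H1 = num_neg_eigenvalues H2.
Proof.
have le12' := relle_form_le sa1 sa2 le12.
have sa1i := selfadjoint_inv sa1; have sa2i := selfadjoint_inv sa2.
split=> [le21|eq12].
  (* One inequality comes from H1 <= H2, the other from the order of the inverses, which have the
     same counts. *)
  apply/eqP; rewrite eqn_leq (form_le_num_neg sa1 sa2 le12') andbT.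
  rewrite -(num_neg_relinv H1) -(num_neg_relinv H2).
  exact: form_le_num_neg (relle_form_le _ _ le21).
apply: form_le_relle => //.
have [B [K neg]] := exists_neg_family sa2.
apply: (form_le_inv sa1 sa2 le12' neg).
have [K1 neg1] := neg_family_form_le sa1 le12' neg.
(* With equal counts, the number of rows of B is the count for H1, so the family is maximal for
   H1. *)
by move: B K neg K1 neg1; rewrite -eq12 => B K _ K1; apply: max_neg_family_nonneg_off.
Qed.
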